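(* There exists an uncountable set $S$ of problems such that any two distinct elements of $S$ are incomparable with respect to $\le_W$ (i.e., neither $f \le_W g$ nor $g \le_W f$), and no $f \in S$ has an $n$-th root for any $n \geq 2$.
   Context: A problem is a partial multivalued function $f:\subseteq \mathbb{N}^\mathbb{N} \rightrightarrows \mathbb{N}^\mathbb{N}$; $\mathrm{dom}(f)$ is the set of $x$ with $f(x)\neq\emptyset$, elements of $\mathrm{dom}(f)$ are instances and elements of $f(x)$ are solutions for $x$. Fix a standard computable pairing $\langle x,y\rangle$ of sequences. $f \le_W g$ (Weihrauch reducibility) holds iff there are partial computable $h,k:\subseteq\mathbb{N}^\mathbb{N}\to\mathbb{N}^\mathbb{N}$ such that for every $x\in\mathrm{dom}(f)$, $k(x)\in\mathrm{dom}(g)$ and for every $y\in g(k(x))$, $h(\langle x,y\rangle)\in f(x)$. Write $f\equiv_W g$ if $f\le_W g$ and $g\le_W f$. The composition $f\circ g$ has domain $\{x\in\mathrm{dom}(g) : g(x)\subseteq \mathrm{dom}(f)\}$ and $(f\circ g)(x)=\{z : \exists y\in g(x),\ z\in f(y)\}$. The compositional product $f*g$ is a problem that is a $\le_W$-maximum of $\{f'\circ g' : f'\le_W f,\ g'\le_W g\}$ (it exists and is unique up to $\equiv_W$). Let $\mathrm{id}$ be the identity on $\mathbb{N}^\mathbb{N}$, $f^{[0]}:=\mathrm{id}$ and $f^{[n]}$ the compositional product of $n$ copies of $f$. For $n\ge 2$, a problem $r$ is an $n$-th root of $f$ iff $f\equiv_W r^{[n]}$. *)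

(* Defs.v *)
From mathcomp Require Import all_boot.
From mathcomp Require Import boolp classical_sets functions cardinality.

Set Implicit Arguments.
Unset Strict Implicit.
Unset Printing Implicit Defensive.

Local Open Scope classical_set_scope.

Definition baire := nat -> nat.

(* The bijection (a, b) |-> 2 ^ a * (2 * b + 1) - 1 and its two inverses. *)
Definition npair (a b : nat) : nat := (2 ^ a * b.*2.+1).-1.
Definition nfst (n : nat) : nat := logn 2 n.+1.
Definition nsnd (n : nat) : nat := (n.+1 %/ 2 ^ logn 2 n.+1)./2.

Lemma npair_succ a b : (npair a b).+1 = 2 ^ a * b.*2.+1.
Proof. by rewrite prednK // muln_gt0 expn_gt0. Qed.

Lemma logn2_npair a b : logn 2 (2 ^ a * b.*2.+1) = a.
Proof.
rewrite lognM ?expn_gt0 // pfactorK // lognE /= dvdn2 /= odd_double /=.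
by rewrite addn0.
Qed.

Lemma nfst_npair a b : nfst (npair a b) = a.
Proof. by rewrite /nfst npair_succ logn2_npair. Qed.

Lemma nsnd_npair a b : nsnd (npair a b) = b.
Proof.
rewrite /nsnd npair_succ logn2_npair mulKn ?expn_gt0 //.
by rewrite -[in RHS](half_bit_double b true).
Qed.

Lemma npair_fst_snd n : npair (nfst n) (nsnd n) = n.
Proof.
have [m m_odd nE] := pfactor_coprime (isT : prime 2) (isT : 0 < n.+1).
rewrite coprime2n in m_odd.
rewrite /npair /nsnd -/(nfst n) [in n.+1 %/ _]nE mulnK ?expn_gt0 //.
have -> : m./2.*2.+1 = m by rewrite -[RHS]odd_double_half m_odd.
by rewrite mulnC -nE.
Qed.

(* Codes for the partial functions from nat to nat that are recursive in an
   oracle: the partial recursive functions of one argument, several arguments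
   being packed with npair, with the oracle as an additional basic function. *)
Inductive code :=
  | Zero | Succ | Fst | Snd | Oracle
  | Pair of code & code
  | Comp of code & code
  | Prec of code & code
  | Mu of code.

Fixpoint prec_graph (R0 R1 : nat -> nat -> Prop) (a k v : nat) : Prop :=
  if k is k'.+1 then
    exists2 u, prec_graph R0 R1 a k' u & R1 (npair a (npair k' u)) v
  else R0 a v.

(* [eval x c n v]: the code c with oracle x halts on input n with value v. *)
Fixpoint eval (x : baire) (c : code) (n v : nat) : Prop :=
  match c with
  | Zero => v = 0
  | Succ => v = n.+1
  | Fst => v = nfst n
  | Snd => v = nsnd n
  | Oracle => v = x n
  | Pair c1 c2 =>
      exists a b, [/\ eval x c1 n a, eval x c2 n b & v = npair a b]
  | Comp c1 c2 => exists2 m, eval x c2 n m & eval x c1 m v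
  | Prec c0 c1 => prec_graph (eval x c0) (eval x c1) (nfst n) (nsnd n) v
  | Mu c1 => eval x c1 (npair n v) 0 /\
      forall i, i < v -> exists m, eval x c1 (npair n i) m.+1
  end.

(* A partial function F on Baire space is computable when some code computes
   F x from every x in the domain of F; as usual in computable analysis,
   nothing is required of the code outside the domain of F. *)
Definition partial_computable (F : baire -> option baire) : Prop :=
  exists c : code, forall x y, F x = Some y -> forall n, eval x c n (y n).

Definition bpair (x y : baire) : baire :=
  fun n => if odd n then y n./2 else x n./2.

(* A partial multivalued function is given by its sets of values, which are
   empty exactly outside its domain. *)
Definition problem := baire -> set baire.

Definition dom (f : problem) : set baire := [set x | f x !=set0].

Definition wle (f g : problem) : Prop :=
  exists h k : baire -> option baire,
    [/\ partial_computable h, partial_computable k &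
      forall x, dom f x ->
        exists z, [/\ k x = Some z, dom g z &
          forall y, g z y -> exists2 w, h (bpair x y) = Some w & f x w]].

Definition wequiv (f g : problem) : Prop := wle f g /\ wle g f.

Definition problem_comp (f g : problem) : problem :=
  fun x => [set z | [/\ dom g x, g x `<=` dom f &
                        exists2 y, g x y & f y z]].

Definition problem_id : problem := fun x => [set x].

Definition wmaximum (A : set problem) (p : problem) : Prop :=
  A p /\ forall q, A q -> wle q p.

(* The compositional product is only determined up to wequiv, so it is a
   relation: p is a compositional product of f and g. *)
Definition is_comp_prod (f g p : problem) : Prop :=
  wmaximum [set q | exists f' g', [/\ wle f' f, wle g' g &
                                      q = problem_comp f' g']] p.

Fixpoint is_comp_power (f : problem) (n : nat) (p : problem) : Prop :=
  if n is m.+1 then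
    exists2 q, is_comp_power f m q & is_comp_prod f q p
  else p = problem_id.

Definition is_root (n : nat) (f r : problem) : Prop :=
  exists2 p, is_comp_power r n p & wequiv f p.

(* Main.v *)
(* Let a and b be sequences such that a is not computable and b is not
   computable from a. The problem f sending 0 to a and a to b, and undefined
   elsewhere, has no root. Suppose that f is equivalent to a power r * q of r,
   q being a lower power.
   Solving f at a forces r to have an instance z1 <=_T a without solutions
   <=_T a: otherwise no power of r would leave the cone below a. Solving f at 0
   through r * q, a call of q yields some y and a call of r on y then makes a,
   hence z1, available. Calling r again, on z1, is a problem "y |-> r z1" below
   r * r <= f. The call of f witnessing this is either at a, so that y computes
   a uniformly and r can be called directly on z1; or at 0, so that a computes
   together with y a solution of z1, and a is obtained by one call of r on y.
   In both cases one call of r after the call of q solves z1, so that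
   "0 |-> r z1" is below r * q <= f, which is impossible since f only returns a
   at 0.
   Reductions between two such problems reduce the corresponding sequences a to
   one another, so it remains to find an uncountable antichain of noncomputable
   Turing degrees. A maximal one is uncountable by the Baire category theorem,
   provided that the a whose upper cone could be nonmeager, which are countably
   many, are left out. *)
From HB Require Import structures.
Require Import Defs.
From mathcomp Require Import all_boot.
From mathcomp Require Import boolp classical_sets functions cardinality.

Set Implicit Arguments.
Unset Strict Implicit.
Unset Printing Implicit Defensive.

Local Open Scope classical_set_scope.

(** * Countability of codes, for the Baire category arguments *)

Fixpoint code_tree (c : code) : GenTree.tree unit :=
  match c with
  | Zero => GenTree.Node 0 [::]
  | Succ => GenTree.Node 1 [::]
  | Fst => GenTree.Node 2 [::]
  | Snd => GenTree.Node 3 [::]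
  | Oracle => GenTree.Node 4 [::]
  | Pair c d => GenTree.Node 5 [:: code_tree c; code_tree d]
  | Comp c d => GenTree.Node 6 [:: code_tree c; code_tree d]
  | Prec c d => GenTree.Node 7 [:: code_tree c; code_tree d]
  | Mu c => GenTree.Node 8 [:: code_tree c]
  end.

Fixpoint tree_code (t : GenTree.tree unit) : option code :=
  match t with
  | GenTree.Node 0 _ => Some Zero
  | GenTree.Node 1 _ => Some Succ
  | GenTree.Node 2 _ => Some Fst
  | GenTree.Node 3 _ => Some Snd
  | GenTree.Node 4 _ => Some Oracle
  | GenTree.Node 5 [:: t; u] =>
      obind (fun c => omap (Pair c) (tree_code u)) (tree_code t)
  | GenTree.Node 6 [:: t; u] =>
      obind (fun c => omap (Comp c) (tree_code u)) (tree_code t)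
  | GenTree.Node 7 [:: t; u] =>
      obind (fun c => omap (Prec c) (tree_code u)) (tree_code t)
  | GenTree.Node 8 [:: t] => omap Mu (tree_code t)
  | _ => None
  end.

Lemma code_treeK : pcancel code_tree tree_code.
Proof.
by elim=> //= [c -> d ->|c -> d ->|c -> d ->|c ->].
Qed.

HB.instance Definition _ := Countable.copy code (pcan_type code_treeK).

(** * Evaluation of codes *)

Lemma prec_graph_fun (R0 R1 : nat -> nat -> Prop) :
  (forall n v w, R0 n v -> R0 n w -> v = w) ->
  (forall n v w, R1 n v -> R1 n w -> v = w) ->
  forall a k v w, prec_graph R0 R1 a k v -> prec_graph R0 R1 a k w -> v = w.
Proof.
move=> R0f R1f a; elim=> [|k IHk] v w /=; first exact: R0f.
by move=> [u ku uv] [u' /(IHk _ _ ku) <- uw]; apply: R1f uv uw.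
Qed.

Lemma eval_fun x c n v w : eval x c n v -> eval x c n w -> v = w.
Proof.
elim: c n v w => /= [|||||c IHc d IHd|c IHc d IHd|c IHc d IHd|c IHc] n v w;
  try by move=> -> ->.
- move=> [a [b [ca db ->]]] [a' [b' [ca' db' ->]]].
  by rewrite (IHc _ _ _ ca ca') (IHd _ _ _ db db').
- by move=> [m dm cm] [m' /(IHd _ _ _ dm) <-]; apply: IHc.
- exact: prec_graph_fun.
- move=> [cv lt_v] [cw lt_w].
  by case: (ltngtP v w) => // [/lt_w|/lt_v] [m cm];
    [have := IHc _ _ _ cv cm | have := IHc _ _ _ cw cm].
Qed.

Definition agree (m : nat) (x y : baire) := forall i, i < m -> y i = x i.

Lemma agreeW m p x y : m <= p -> agree p x y -> agree m x y.
Proof. by move=> mp xy i im; apply/xy/leq_trans/mp. Qed.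

Lemma agree_max m p x y :
  agree (maxn m p) x y -> agree m x y /\ agree p x y.
Proof.
by split; [apply: agreeW (leq_maxl m p) _|apply: agreeW (leq_maxr m p) _].
Qed.

(** A halting computation queries its oracle finitely often. For [Mu], a common bound for the uses
    below [v] comes by induction on [v]. *)
Lemma eval_use x c n v :
  eval x c n v -> exists m, forall y, agree m x y -> eval y c n v.
Proof.
elim: c n v => /= [|||||c IHc d IHd|c IHc d IHd|c IHc d IHd|c IHc] n v;
  try by move=> ->; exists 0.
- by move=> ->; exists n.+1 => y /(_ n (ltnSn n)) ->.
- move=> [a [b [/IHc[m mP] /IHd[p pP] ->]]].
  exists (maxn m p) => y /agree_max[/mP ya /pP yb]; by exists a, b.
- move=> [k /IHd[m mP] /IHc[p pP]].
  by exists (maxn m p) => y /agree_max[/mP ? /pP ?]; exists k.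
- elim: (nsnd n) v => [|k IHk] v /=; first exact: IHc.
  move=> [u /IHk[m mP] /IHd[p pP]].
  by exists (maxn m p) => y /agree_max[/mP ? /pP ?]; exists u.
- move=> [/IHc[m mP] lt_v].
  suff [p pP] : exists p, forall y, agree p x y ->
      forall i, i < v -> exists k, eval y c (npair n i) k.+1.
    by exists (maxn m p) => y /agree_max[/mP ? /pP ?].
  elim: v lt_v {mP} => [|v IHv] lt_v; first by exists 0.
  have [i /leqW /lt_v //|p pP] := IHv.
  have [k /IHc[q qP]] := lt_v _ (ltnSn v).
  exists (maxn p q) => y /agree_max[/pP yp /qP yq] i.
  by rewrite ltnS leq_eqVlt => /predU1P[->|/yp//]; exists k.
Qed.

Fixpoint subst (d c : code) : code :=
  match c with
  | Oracle => d
  | Pair c1 c2 => Pair (subst d c1) (subst d c2)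
  | Comp c1 c2 => Comp (subst d c1) (subst d c2)
  | Prec c1 c2 => Prec (subst d c1) (subst d c2)
  | Mu c => Mu (subst d c)
  | _ => c
  end.

Lemma eval_subst x y d c n v : (forall n, eval x d n (y n)) ->
  eval y c n v -> eval x (subst d c) n v.
Proof.
move=> xdy; elim: c n v => //= [|c IHc e IHe|c IHc e IHe|c IHc e IHe|c IHc] n v.
- by move=> ->.
- by move=> [a [b [/IHc ? /IHe ? ->]]]; exists a, b.
- by move=> [m /IHe ? /IHc ?]; exists m.
- elim: (nsnd n) v => [|k IHk] v /=; first exact: IHc.
  by move=> [u /IHk ? /IHe ?]; exists u.
- move=> [/IHc ? lt_v]; split=> // i /lt_v[m /IHc ?]; by exists m.
Qed.

Definition Id := Pair Fst Snd.

Lemma eval_id x n : eval x Id n n.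
Proof. by exists (nfst n), (nsnd n); rewrite npair_fst_snd. Qed.

Fixpoint Const k := if k is k'.+1 then Comp Succ (Const k') else Zero.

Lemma eval_const x k n : eval x (Const k) n k.
Proof. by elim: k => //= k IHk; exists k. Qed.

(** The recursion step discards the previous value and returns its counter. *)
Definition Pred := Comp (Prec Zero (Comp Fst Snd)) (Pair Id Id).

Lemma eval_pred x n : eval x Pred n n.-1.
Proof.
exists (npair n n); first by exists n, n; split=> //; exact: eval_id.
rewrite /= nfst_npair nsnd_npair; elim: n {1}n => [|n IHn] m //=.
exists n.-1 => //; exists (npair n n.-1); first by rewrite nsnd_npair.
by rewrite nfst_npair.
Qed.

Definition Rec d e a c := Comp (Prec d e) (Pair a c).

Lemma eval_rec0 x d e a c n m v :
  eval x a n m -> eval x c n 0 -> eval x d m v -> eval x (Rec d e a c) n v.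
Proof.
move=> am c0 dv; exists (npair m 0); first by exists m, 0.
by rewrite /= nfst_npair nsnd_npair.
Qed.

(** With a constant step, recursion becomes a case distinction on [c]; the base [d] is evaluated in
    any case, so it has to halt. *)
Lemma eval_recS x d e a c n m k u v :
  eval x a n m -> eval x c n k.+1 -> eval x d m u ->
  (forall i, eval x e (npair m i) v) -> eval x (Rec d e a c) n v.
Proof.
move=> am ck du ev; exists (npair m k.+1); first by exists m, k.+1.
rewrite /= nfst_npair nsnd_npair; elim: k {ck} => [|k IHk]; first by exists u.
by exists v.
Qed.

(* [Guard c d] evaluates [d] only where [c] does not vanish; a mere
   [Rec d (Comp e Fst) Id c] would need both branches of the conditional. *)
Definition Guard c d := Rec Zero (Comp d Fst) Id c.
Definition IsZero c := Rec (Const 1) Zero Id c.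
Definition If c d e :=
  Rec Fst (Comp Snd Fst) (Pair (Guard (IsZero c) d) (Guard c e)) c.

Lemma eval_guard0 x c d n : eval x c n 0 -> eval x (Guard c d) n 0.
Proof. by move=> c0; apply: eval_rec0 (eval_id x n) c0 _. Qed.

Lemma eval_guardS x c d n k v :
  eval x c n k.+1 -> eval x d n v -> eval x (Guard c d) n v.
Proof.
move=> ck dv.
apply: eval_recS (eval_id x n) ck (erefl : eval x Zero n 0) _ => i.
by exists n; rewrite //= nfst_npair.
Qed.

Lemma eval_if0 x c d e n v :
  eval x c n 0 -> eval x d n v -> eval x (If c d e) n v.
Proof.
move=> c0 dv; apply: (@eval_rec0 _ _ _ _ _ _ (npair v 0) _ _ c0).
  exists v, 0; split=> //; last exact: eval_guard0.
  apply: (@eval_guardS _ _ _ _ 0) dv.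
  exact: (eval_rec0 _ (eval_id x n) c0 (eval_const x 1 n)).
by rewrite /= nfst_npair.
Qed.

Lemma eval_ifS x c d e n k v :
  eval x c n k.+1 -> eval x e n v -> eval x (If c d e) n v.
Proof.
move=> ck ev; apply: (@eval_recS _ _ _ _ _ _ (npair 0 v) _ 0 _ _ ck).
- exists 0, v; split=> //; last exact: eval_guardS ck ev.
  by apply: eval_guard0; apply: (eval_recS (eval_id x n) ck (eval_const x 1 _)).
- by rewrite /= nfst_npair.
- by move=> i; exists (npair 0 v); rewrite /= ?nfst_npair ?nsnd_npair.
Qed.

(** * Computable partial functions on Baire space *)

Definition lft (x : baire) : baire := fun n => x n.*2.
Definition rgt (x : baire) : baire := fun n => x n.*2.+1.

Lemma lft_bpair x y : lft (bpair x y) = x.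
Proof. by apply/funext => n; rewrite /lft /bpair odd_double doubleK. Qed.

Lemma rgt_bpair x y : rgt (bpair x y) = y.
Proof.
by apply/funext => n; rewrite /rgt /bpair /= odd_double /= uphalf_double.
Qed.

Lemma npair0 n : npair 0 n = n.*2.
Proof. by rewrite /npair mul1n. Qed.

Definition Double := Pair Zero Id.

Lemma eval_double x n : eval x Double n n.*2.
Proof.
by exists 0, n; split=> //; [exact: eval_id | rewrite npair0].
Qed.

Lemma pc_some : partial_computable Some.
Proof. by exists Oracle => x y [->]. Qed.

Lemma pc_zero : partial_computable (fun=> Some (fun=> 0)).
Proof. by exists Zero => x y [<-]. Qed.

Lemma pc_lft : partial_computable (Some \o lft).
Proof.
exists (Comp Oracle Double) => x _ [<-] n.
exists n.*2 => //; exact: eval_double.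
Qed.

Lemma pc_rgt : partial_computable (Some \o rgt).
Proof.
exists (Comp Oracle (Comp Succ Double)) => x _ [<-] n.
exists n.*2.+1 => //; exists n.*2 => //; exact: eval_double.
Qed.

Lemma pc_bind F G : partial_computable F -> partial_computable G ->
  partial_computable (obind F \o G).
Proof.
move=> [c cF] [d dG]; exists (subst d c) => x y /=.
case Gx: (G x) => [z|] //= Fz n.
by apply: (@eval_subst _ z); [exact: dG | exact: cF].
Qed.

Definition opair (F G : baire -> option baire) x : option baire :=
  obind (fun y => omap (bpair y) (G x)) (F x).

(** [Fst] is the 2-adic valuation of [n.+1]: it vanishes exactly at even [n], where [Snd] halves
    [n]. An odd [n] is halved through its predecessor. *)
Lemma eval_bpair x y z c d : (forall n, eval z c n (x n)) ->
  (forall n, eval z d n (y n)) ->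
  forall n,
    eval z (If Fst (Comp c Snd) (Comp d (Comp Snd Pred))) n (bpair x y n).
Proof.
move=> cx dy n; rewrite /bpair.
have := odd_double_half n; case: (odd n) => [|] def_n.
  have [k nk] : exists k, nfst n = k.+1.
    exists (nfst n).-1; rewrite prednK //.
    rewrite -def_n /nfst logn_gt0 mem_primes /= dvdn2 /= odd_double //.
  apply: (@eval_ifS _ _ _ _ _ k) => //=; exists n./2; last exact: dy.
  exists n.-1; first exact: eval_pred.
  by rewrite /= -[n in n.-1]def_n -npair0 nsnd_npair.
apply: eval_if0; first by rewrite /= -def_n -npair0 nfst_npair.
by exists n./2; [rewrite /= -{2}def_n -npair0 nsnd_npair | exact: cx].
Qed.

Lemma pc_pair F G : partial_computable F -> partial_computable G ->
  partial_computable (opair F G).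
Proof.
move=> [c cF] [d dG].
exists (If Fst (Comp c Snd) (Comp d (Comp Snd Pred))) => x y.
rewrite /opair; case Fx: (F x) => [u|] //=; case Gx: (G x) => [v|] //= [<-] n.
by apply: eval_bpair; [exact: cF | exact: dG].
Qed.

(** One value of [T x] decides, and only the selected branch has to be defined. *)
Lemma pc_if N T F G : partial_computable T ->
  partial_computable F -> partial_computable G ->
  partial_computable
    (fun x => obind (fun t : baire => if t N == 0 then F x else G x) (T x)).
Proof.
move=> [b bT] [c cF] [d dG]; exists (If (Comp b (Const N)) c d) => x y.
case Tx: (T x) => [t|] // Fy n; move: Fy; rewrite [obind _ _]/=.
have : eval x (Comp b (Const N)) n (t N).
  by exists N; [exact: eval_const | exact: bT].
case: (t N) => [|k] tN Fy; first by apply: eval_if0 tN _; exact: cF.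
by apply: eval_ifS tN _; exact: dG.
Qed.

(** * Turing reducibility *)

Definition tle (x y : baire) := exists c, forall n, eval y c n (x n).

Lemma tle_refl x : tle x x.
Proof. by exists Oracle. Qed.

Lemma tle_trans y x z : tle x y -> tle y z -> tle x z.
Proof.
by move=> [c cx] [d dy]; exists (subst d c) => n; apply: eval_subst (cx n).
Qed.

Lemma tle_zero x : tle (fun=> 0) x.
Proof. by exists Zero. Qed.

Lemma tle_bpair x y z : tle x z -> tle y z -> tle (bpair x y) z.
Proof. by move=> [c cx] [d dy]; eexists; apply: eval_bpair cx dy. Qed.

Lemma pc_tle F x y : partial_computable F -> F x = Some y -> tle y x.
Proof. by move=> [c cF] /cF; exists c. Qed.

(** The domain is a single point, so a nonuniform reduction is enough. *)
Lemma pc_const x y : tle y x ->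
  partial_computable (fun u => if `[< u = x >] then Some y else None).
Proof. by move=> [c cy]; exists c => u v; case: asboolP => // -> [<-]. Qed.

(** * Weihrauch reducibility *)

Lemma wle_refl f : wle f f.
Proof.
exists (Some \o rgt), Some; split; [exact: pc_rgt | exact: pc_some|].
by move=> x fx; exists x; split=> // y fxy; exists y; rewrite //= rgt_bpair.
Qed.

Lemma wle_trans g f e : wle f g -> wle g e -> wle f e.
Proof.
move=> [h [k [ch ck fg]]] [h' [k' [ch' ck' ge]]].
exists (obind h \o opair (Some \o lft)
  (obind h' \o opair (obind k \o (Some \o lft)) (Some \o rgt))).
exists (obind k' \o k); split.
- apply: pc_bind => //; apply: pc_pair pc_lft _.
  by apply: pc_bind => //; apply: pc_pair pc_rgt; apply: pc_bind pc_lft.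
- exact: pc_bind.
move=> x /fg[z [kx gz fz]]; have [t [kz et gt]] := ge _ gz.
exists t; split=> //=; first by rewrite kx.
move=> y /gt[u hu /fz[w hw fw]]; exists w => //.
by rewrite /opair /= lft_bpair rgt_bpair kx /= hu.
Qed.

Lemma comp_prod_wle f g p f' g' : is_comp_prod f g p ->
  wle f' f -> wle g' g -> wle (problem_comp f' g') p.
Proof. by move=> [_ pmax] ? ?; apply: pmax; exists f', g'. Qed.

(** Precomposing [f] with the identity on [dom f] gives back [f]. *)
Lemma wle_comp_prod_r f g p : is_comp_prod f g p ->
  wle (fun x => [set y | dom f x /\ y = x]) g -> wle f p.
Proof.
move=> fgp /(comp_prod_wle fgp (wle_refl f)); apply: wle_trans.
exists (Some \o rgt), Some; split; [exact: pc_rgt | exact: pc_some|].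
move=> x fx; exists x; split=> //.
  case: (fx) => z fxz; exists z; split; first by exists x.
    by move=> _ [_ ->].
  by exists x.
move=> y [_ _ [_ [_ ->] fxy]]; exists y => //; by rewrite /= rgt_bpair.
Qed.

Lemma wle_power r m q : is_comp_power r m.+1 q -> wle r q.
Proof.
elim: m q => [|m IHm] q /= [s rs rsq]; apply: (wle_comp_prod_r rsq).
  rewrite rs; exists (Some \o lft), Some.
  split; [exact: pc_lft | exact: pc_some|].
  move=> x [_ [fx _]]; exists x; split=> //; first by exists x.
  by move=> y _; exists x; rewrite //= lft_bpair.
(* The identity on [dom r] is below [r]: call [r] and ignore the answer. *)
apply: wle_trans (IHm _ rs).
exists (Some \o lft), Some; split; [exact: pc_lft | exact: pc_some|].
move=> x [_ [fx _]]; exists x; split=> // y _.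
by exists x; rewrite //= lft_bpair.
Qed.

(** A nonuniform way to say that [f] does not lead out of the Turing cone below [p]; it passes to
    reducible problems and to powers. *)
Definition trivial_below (p : baire) (f : problem) :=
  forall z, tle z p -> dom f z -> exists2 y, f z y & tle y p.

Lemma trivial_below_wle p f g :
  wle f g -> trivial_below p g -> trivial_below p f.
Proof.
move=> [h [k [ch ck fg]]] gp z zp /fg[t [kz gt]] sol.
have [y gty yp] := gp t (tle_trans (pc_tle ck kz) zp) gt.
have [w hw fw] := sol y gty; exists w => //.
exact: tle_trans (pc_tle ch hw) (tle_bpair zp yp).
Qed.

Lemma trivial_below_comp p f g : trivial_below p f -> trivial_below p g ->
  trivial_below p (problem_comp f g).
Proof.
move=> fp gp z zp [_ [gz gf _]]; have [y gy yp] := gp z zp gz.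
have [w fw wp] := fp y yp (gf y gy).
by exists w => //; split=> //; exists y.
Qed.

Lemma trivial_below_power p r n q : trivial_below p r ->
  is_comp_power r n q -> trivial_below p q.
Proof.
move=> rp; elim: n q => [|n IHn] q /=; first by move=> -> z zp _; exists z.
move=> [s /IHn sp [[f [g [fr gs ->]]] _]].
apply: trivial_below_comp; first exact: trivial_below_wle fr rp.
exact: trivial_below_wle gs sp.
Qed.

(** * An uncountable antichain of Turing degrees *)

Definition cylinder (s : seq nat) : set baire :=
  [set x | forall i, i < size s -> x i = nth 0 s i].

Lemma cylinder_catl s t x : cylinder (s ++ t) x -> cylinder s x.
Proof.
move=> xst i is_; rewrite xst ?nth_cat ?is_ //.
by rewrite size_cat ltn_addr.
Qed.

Definition nowhere_dense (E : set baire) :=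
  forall s, exists t, forall x, cylinder (s ++ t) x -> ~ E x.

Lemma baire_category (T : countType) (E : T -> set baire) :
  (forall t, nowhere_dense (E t)) -> exists x, forall t, ~ E t x.
Proof.
move=> nwE; pose step n s t :=
  if unpickle n is Some i then forall x, cylinder (s ++ t) x -> ~ E i x
  else True.
have /choice[ext extP] p : exists t, step p.1 p.2 t.
  rewrite /step; case: unpickle => [i|]; last by exists [::].
  exact: nwE.
(* The final 0 makes [s n] have length at least [n], so that the limit has a value everywhere, read
   off at stage [i.+1]. *)
pose s := fix s n :=
  if n is m.+1 then (s m ++ ext (m, s m)) ++ [:: 0] else [::].
have size_s n : n <= size (s n).
  elim: n => //= n IHn; rewrite !size_cat addn1 ltnS.
  exact: leq_trans IHn (leq_addr _ _).
have s_nth m n i : m <= n -> i < size (s m) -> nth 0 (s n) i = nth 0 (s m) i.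
  move=> /subnK <-; elim: (n - m) => // d IHd im; rewrite addSn /=.
  have lt_i : i < size (s (d + m)).
    elim: d {IHd} => //= d IHd; rewrite !size_cat -addnA.
    exact: leq_trans IHd (leq_addr _ _).
  by rewrite -catA nth_cat lt_i IHd.
exists (fun i => nth 0 (s i.+1) i) => t Et.
have := extP (pickle t, s (pickle t)); rewrite /step /= pickleK => /(_ _ _ Et).
apply; apply: (@cylinder_catl _ [:: 0]) => i im.
rewrite -[_ ++ _]/(s (pickle t).+1) in im *.
have [le|/ltnW le] := leqP i.+1 (pickle t).+1.
  by rewrite (s_nth _ _ _ le).
by rewrite (s_nth _ _ _ le im).
Qed.

Lemma nowhere_dense_sub1 (E : set baire) :
  (forall x y, E x -> E y -> x = y) -> nowhere_dense E.
Proof.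
move=> E1 s; have [[e Ee]|nE] := pselect (exists e, E e); last first.
  by exists [::] => x _ Ex; apply: nE; exists x.
(* One more entry, chosen to differ from [e], excludes the only element. *)
exists [:: (e (size s)).+1] => x xs /E1/(_ Ee) ex.
have := xs (size s); rewrite size_cat addn1 ltnSn => /(_ isT).
by rewrite nth_cat ltnn subnn /= ex => /n_Sn.
Qed.

(** As [c] and [s] determine [a], only countably many sequences are forced; all others have a meager
    upper cone. *)
Definition forced (c : code) (s : seq nat) (a : baire) :=
  (forall n, exists2 x, cylinder s x & eval x c n (a n)) /\
  forall x n v, cylinder s x -> eval x c n v -> v = a n.

Lemma forced_fun c s a b : forced c s a -> forced c s b -> a = b.
Proof.
move=> [ca _] [_ cb]; apply/funext => n.
by have [x xs /(cb _ _ _ xs)] := ca n.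
Qed.

(** Either some [a n] is never output on the cylinder of [s], which then needs no extension, or some
    [x] in it gives a wrong value, and by the use principle a finite part of [x] preserves the
    error. *)
Lemma nowhere_dense_cone c a : (forall s, ~ forced c s a) ->
  nowhere_dense [set b | forall n, eval b c n (a n)].
Proof.
move=> nf s; have /not_andP[/existsNP[n nP]|] := nf s.
  exists [::] => x; rewrite cats0 => xs xa; apply: nP.
  by exists x.
move=> /existsNP[x /existsNP[n /existsNP[v]]].
move=> /not_implyP[xs /not_implyP[xv va]].
have [m mP] := eval_use xv.
(* The next [m] values of [x] after [s] cover the use [m]. *)
exists (mkseq (fun i => x (size s + i)) m) => y ys ya.
apply: va; apply: eval_fun (ya n); apply: mP => i im.
have [lt_is|le_si] := ltnP i (size s).
  by rewrite xs // (cylinder_catl ys).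
rewrite ys ?size_cat ?size_mkseq; last by rewrite ltn_addl.
rewrite nth_cat ltnNge le_si /= nth_mkseq ?subnKC //.
by apply: leq_ltn_trans im; rewrite leq_subr.
Qed.

Lemma exists_not_tle a : exists b, ~ tle b a.
Proof.
have [|b nb] := @baire_category code (fun c b => forall n, eval a c n (b n)).
  move=> c; apply: nowhere_dense_sub1 => x y xa ya; apply/funext => n.
  exact: eval_fun (xa n) (ya n).
by exists b => -[c /nb].
Qed.

Lemma uncountable_antichain : exists A : set baire,
  [/\ ~ countable A, forall a, A a -> ~ tle a (fun=> 0) &
      forall a b, A a -> A b -> a <> b -> ~ tle a b].
Proof.
pose P (A : set baire) :=
  [/\ forall a, A a -> forall c s, ~ forced c s a,
      forall a, A a -> ~ tle a (fun=> 0) &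
      forall a b, A a -> A b -> a <> b -> ~ tle a b].
have [|A [[Af A0 Aa] Amax]] := @Zorn_bigcup _ P.
  move=> F FP totF; split.
  - by move=> a [X /FP[Xf _ _]]; apply: Xf.
  - by move=> a [X /FP[_ X0 _]]; apply: X0.
  move=> a b [X FX Xa] [Y FY Yb].
  have [XY|YX] := totF _ _ FX FY.
    by have [_ _ Ya] := FP _ FY; apply: Ya => //; apply: XY.
  by have [_ _ Xa'] := FP _ FX; apply: Xa' => //; apply: YX.
exists A; split=> // /countable_injP[f finj].
have {}finj a b : A a -> A b -> f a = f b -> a = b.
  by move=> Aa' Ab; apply: finj; rewrite inE.
(* What a new member has to avoid: sequences below a member, above a member, computable, or forced.
   Members are named by their numbers under [f]. *)
pose T := ((nat * code) + (nat * code) + code + (code * seq nat))%type.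
pose E (t : T) : set baire := match t with
  | inl (inl (inl (i, c))) =>
      [set b | exists a, [/\ A a, f a = i & forall n, eval a c n (b n)]]
  | inl (inl (inr (i, c))) =>
      [set b | exists a, [/\ A a, f a = i & forall n, eval b c n (a n)]]
  | inl (inr c) => [set b | forall n, eval (fun=> 0) c n (b n)]
  | inr (c, s) => [set b | forced c s b]
  end.
have [|b nb] := @baire_category T E.
  move=> [[[[i c]|[i c]]|c]|[c s]] /=.
  - apply: nowhere_dense_sub1 => x y [a [Aa' <- ax]] [a' [/finj h /h -> // ay]].
    apply/funext => n; exact: eval_fun (ax n) (ay n).
  - have [[a [Aa' fa]]|nA] := pselect (exists a, A a /\ f a = i); last first.
      apply: nowhere_dense_sub1 => x y [a [Aa' fa _]]; case: nA.
      by exists a.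
    move=> s; have [t tP] := nowhere_dense_cone (Af _ Aa' c) s.
    exists t => x /tP nx [a' [Aa'' fa' xa]]; apply: nx => n.
    by rewrite (finj a a') // fa fa'.
  - apply: nowhere_dense_sub1 => x y ax ay; apply/funext => n.
    exact: eval_fun (ax n) (ay n).
  - by apply: nowhere_dense_sub1 => x y; exact: forced_fun.
have Ab a : A a -> ~ tle a b /\ ~ tle b a.
  move=> Aa'; split=> -[c ca].
    by apply: (nb (inl (inl (inr (f a, c))))); exists a.
  by apply: (nb (inl (inl (inl (f a, c))))); exists a.
apply: (Amax (b |` A)).
  split; first by move=> a; right.
  by move=> /(_ b (or_introl erefl))/Ab[[]]; exact: tle_refl.
split.
- by move=> a [->|/Af//] c s fc; exact: (nb (inr (c, s))).
- by move=> a [->|/A0//] [c ca]; exact: (nb (inl (inr c))).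
- move=> a a' [->|Aa'] [->|Aa''] //; last exact: Aa.
    by case: (Ab _ Aa'').
  by case: (Ab _ Aa').
Qed.

(** * Two-step problems *)

Definition two_step (a b : baire) : problem := fun x =>
  [set y | (x = (fun=> 0) /\ y = a) \/ (x = a /\ y = b)].

(** At 0 the query is computable, hence 0; its answer [a'] must then compute [a]. *)
Lemma two_step_wle a b a' b' : ~ tle a (fun=> 0) -> ~ tle a' (fun=> 0) ->
  wle (two_step a b) (two_step a' b') -> tle a a'.
Proof.
move=> a0 a'0 [h [k [ch ck fg]]].
have [|z [kz [y zy] hz]] := fg (fun=> 0); first by exists a; left.
have z0 : z = fun=> 0.
  by case: zy => -[// ez _]; case: a'0; rewrite -ez; apply: pc_tle ck kz.
have [|w hw] := hz a'; first by left.
case=> -[ea ew]; last by case: a0; rewrite -ea; exact: tle_refl.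
rewrite -ew; apply: tle_trans (pc_tle ch hw) _.
by apply: tle_bpair (tle_zero _) (tle_refl _).
Qed.

Lemma two_step_at0 a b x y : ~ tle a (fun=> 0) -> tle x (fun=> 0) ->
  two_step a b x y -> x = (fun=> 0) /\ y = a.
Proof. by move=> a0 x0 [//|[ex _]]; case: a0; rewrite -ex. Qed.

(** The argument is run without contradiction: the last reduction solves [z1] by a query whose
    answer is [a], hence computably in [a]. *)
Lemma two_step_no_split a b r q p :
  ~ tle a (fun=> 0) -> wle r q -> is_comp_prod r q p ->
  wequiv (two_step a b) p -> trivial_below a r.
Proof.
move=> a0 rq pP [[h0 [k0 [ch0 ck0 fp]]] pf] z1 z1a rz1.
(* A maximum belongs to its set, so [p] is itself a composition. *)
have [[f1 [g1 [f1r g1q def_p]]] _] := pP.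
have [|x0 [kx0 px0 hx0]] := fp (fun=> 0); first by exists a; left.
have h0E u : p x0 u -> h0 (bpair (fun=> 0) u) = Some a.
  move=> /hx0[w -> /(two_step_at0 a0)[]]; first exact: tle_zero.
  by move=> _ ->.
have {px0} [gx0 gf] : dom g1 x0 /\ g1 x0 `<=` dom f1.
  by have [y] := px0; rewrite def_p => -[].
have {}h0E y u : g1 x0 y -> f1 y u -> h0 (bpair (fun=> 0) u) = Some a.
  by move=> gy fu; apply: h0E; rewrite def_p; split=> //; exists y.
pose call := fun u : baire => if `[< u = a >] then Some z1 else None.
have callE : call a = Some z1 by rewrite /call; case: asboolP.
have ccall : partial_computable call by exact: pc_const.
pose toa := obind h0 \o opair (fun=> Some (fun=> 0)) Some.
have ctoa : partial_computable toa.
  by apply: pc_bind => //; apply: pc_pair pc_zero pc_some.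
have toaE y u : g1 x0 y -> f1 y u -> toa u = Some a.
  by move=> gy fu; rewrite /toa /= -(h0E y u).
(* [B] solves [z1] from any [u] that yields [a]. After [f1], it is the problem that calls [r] again
   on [z1]; [f1] fits as inner factor because [r] is below [q]. *)
pose B : problem := fun u => [set s | toa u = Some a /\ r z1 s].
have Br : wle B r.
  exists (Some \o rgt), (obind call \o toa).
  split; [exact: pc_rgt | exact: pc_bind |].
  move=> u [s [ua _]]; exists z1; split=> //; first by rewrite /= ua.
  by move=> t rt; exists t; rewrite //= rgt_bpair.
have [h3 [k3 [ch3 ck3 Bf]]] :
    wle (problem_comp B f1) (two_step a b).
  apply: wle_trans pf; apply: comp_prod_wle pP Br _.
  exact: wle_trans f1r rq.
have {}Bf y : g1 x0 y -> exists2 z, k3 y = Some z &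
    (z = (fun=> 0) /\ exists2 w, h3 (bpair y a) = Some w & r z1 w) \/ z = a.
  move=> gy; have [|z [kz [v zv] hz]] := Bf y.
    have [u fu] := gf y gy; have [s rs] := rz1; exists s; split.
    - by exists u.
    - by move=> t ft; exists s; split=> //; exact: toaE ft.
    - by exists u => //; split=> //; exact: toaE fu.
  exists z => //; case: zv => -[ez _]; [left|by right]; split=> //.
  have [|w hw [_ _ [? _ [_ rw]]]] := hz a; first by rewrite ez; left.
  by exists w.
(* Position [N] tells the two possible queries 0 and [a] apart computably. *)
have [N aN] : exists N, a N <> 0.
  apply: contrapT => /forallNP aN; case: a0.
  rewrite (_ : a = fun=> 0); first exact: tle_refl.
  by apply/funext => n; apply: contrapT; exact: aN.
(* Confining [C] to [g1 x0] makes [Bf] and the reduction of [f1] available. *)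
pose C : problem := fun y => [set s | g1 x0 y /\ r z1 s].
have [h1 [k1 [ch1 ck1 fr]]] := f1r.
(* From a solution [y] of [g1] at [x0], [k3 y] either equals [a], which gives
   the instance [z1], or vanishes; then calling [r] on [k1 y] yields [a],
   from which [h3] solves [z1]. *)
have Cr : wle C r.
  pose T := k3 \o lft.
  exists (fun t => obind (fun v : baire => if v N == 0 then
      (obind h3 \o opair (Some \o lft) (obind toa \o h1)) t
      else Some (rgt t)) (T t)).
  exists (fun t => obind (fun v : baire => if v N == 0 then k1 t
      else (obind call \o k3) t) (k3 t)).
  split.
  - apply: pc_if; last exact: pc_rgt.
      exact: (pc_bind ck3 pc_lft).
    by apply: pc_bind => //; apply: pc_pair pc_lft _; exact: pc_bind.
  - by apply: pc_if => //; exact: pc_bind.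
  move=> y [_ [gy _]]; have [z kz [[z0 [w hw rw]]|za]] := Bf y gy.
    have [x [kx rx hx]] := fr y (gf y gy); exists x; split=> //.
      by rewrite kz /= z0 eqxx.
    move=> t /hx[u hu fu]; exists w => //.
    rewrite /T /= lft_bpair kz /= z0 eqxx /= /opair /= lft_bpair hu /=.
    by rewrite (toaE y u).
  have aN0 : (z N == 0) = false by apply/eqP; rewrite za.
  exists z1; split=> //; first by rewrite /= kz /= aN0 za.
  by move=> t rt; exists t => //; rewrite /T /= lft_bpair kz /= aN0 rgt_bpair.
have [h4 [k4 [ch4 ck4 Cf]]] : wle (problem_comp C g1) (two_step a b).
  by apply: wle_trans pf; apply: comp_prod_wle pP Cr g1q.
have x00 : tle x0 (fun=> 0) by exact: pc_tle ck0 kx0.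
have [|z [kz [v zv] hz]] := Cf x0.
  have [s rs] := rz1; have [y gy] := gx0; exists s; split=> //.
    by move=> t gt; exists s.
  by exists y.
have [ez _] := two_step_at0 a0 (tle_trans (pc_tle ck4 kz) x00) zv.
have [|w hw [_ _ [? _ [_ rw]]]] := hz a; first by rewrite ez; left.
exists w => //; apply: tle_trans (pc_tle ch4 hw) _.
by apply: tle_bpair (tle_refl _); apply: tle_trans x00 (tle_zero _).
Qed.

(** For exponent at least 2 the inner power is a positive power, hence above [r]. Then the powers of
    [r] stay in the cone below [a], whereas the instance [a] has the solution [b] only. *)
Lemma two_step_no_root a b n r :
  ~ tle a (fun=> 0) -> ~ tle b a -> 2 <= n -> ~ is_root n (two_step a b) r.
Proof.
move=> a0 ba; case: n => [|[|n]] // _ [p rp fp].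
have ra : trivial_below a r.
  have [q rq pq] := rp.
  exact: two_step_no_split a0 (wle_power rq) pq fp.
have [|y] := trivial_below_wle fp.1 (trivial_below_power ra rp) (tle_refl a).
  by exists b; right.
case=> -[ea ey]; first by case: a0; rewrite {1}ea; exact: tle_refl.
by rewrite ey.
Qed.

Theorem theorem1p6 :
  exists S : set problem,
    [/\ ~ countable S,
        forall f g : problem, S f -> S g -> f <> g -> ~ wle f g /\ ~ wle g f
      & forall f : problem, S f ->
          forall n : nat, 2 <= n -> ~ exists r : problem, is_root n f r].
Proof.
have [A [Auncount A0 Aanti]] := uncountable_antichain.
have [next nextP] := choice exists_not_tle.
pose F a := two_step a (next a).
(* This yields incomparability and also the injectivity of [F] on [A], hence uncountability of the
   image. *)
have wleF a b : A a -> A b -> wle (F a) (F b) -> a = b.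
  move=> Aa Ab /two_step_wle ab; apply: contrapT => neq.
  by apply: (Aanti a b) => //; apply: ab; exact: A0.
exists (F @` A); split.
- move=> /countable_injP[g ginj]; apply: Auncount; apply/countable_injP.
  exists (g \o F) => a b; rewrite !inE => Aa Ab /ginj Fab.
  apply: wleF => //; rewrite Fab; [exact: wle_refl | |]; rewrite inE.
  + by exists a.
  + by exists b.
- move=> _ _ [a Aa <-] [b Ab <-] neq.
  by split=> /wleF ab; apply: neq; rewrite ab.
- move=> _ [a Aa <-] n n2 [r]; apply: two_step_no_root n2 => //; exact: A0.
Qed.
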